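(* Let $(\mathsf{C},\bullet)$ be a linear monoidal category. (i) If $(D,\prec,\succ)$ is a dendriform monoid in $\mathsf{C}$, then the map $\cdot\colon D\bullet D\to D$ defined by $\cdot\;=\;\succ+\prec$ turns $D$ into an associative monoid in $\mathsf{C}$. (ii) If $R\colon A\to A$ is a Rota--Baxter operator on an associative monoid $(A,\mu)$ in $\mathsf{C}$, then the maps $A\bullet A\to A$ defined by $$\prec\;=\;\mu\circ(\mathrm{id}\bullet R)\qquad\text{and}\qquad \succ\;=\;\mu\circ(R\bullet\mathrm{id})$$ turn $A$ into a dendriform monoid in $\mathsf{C}$.
   Context: Let $\mathbb{K}$ be a field. A linear monoidal category $(\mathsf{C},\bullet)$ is a (not necessarily unital) monoidal category whose hom-sets are $\mathbb{K}$-vector spaces and for which composition and the tensor product $\bullet$ of morphisms are $\mathbb{K}$-bilinear. Associativity constraints are suppressed from the notation. An associative monoid in $\mathsf{C}$ is an object $A$ with a map $\mu\colon A\bullet A\to A$ such that $\mu(\mathrm{id}\bullet\mu)=\mu(\mu\bullet\mathrm{id})$ as maps $A\bullet A\bullet A\to A$ (no unit is required). A dendriform monoid in $\mathsf{C}$ is an object $D$ with maps $\prec,\succ\colon D\bullet D\to D$ such that, writing $\cdot=\prec+\succ$, the following hold as maps $D\bullet D\bullet D\to D$: $$\prec(\prec\bullet\,\mathrm{id})=\;\prec(\mathrm{id}\bullet\cdot),\qquad \prec(\succ\bullet\,\mathrm{id})=\;\succ(\mathrm{id}\bullet\prec),\qquad \succ(\cdot\bullet\mathrm{id})=\;\succ(\mathrm{id}\bullet\succ).$$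 A Rota--Baxter operator on an associative monoid $(A,\mu)$ in $\mathsf{C}$ is a map $R\colon A\to A$ such that $\mu(R\bullet R)=R\,\mu\,(R\bullet\mathrm{id}+\mathrm{id}\bullet R)$ as maps $A\bullet A\to A$. *)

(* Defs.v *)
From mathcomp Require Import all_boot all_order all_algebra.
Set Implicit Arguments.
Unset Strict Implicit.
Unset Printing Implicit Defensive.
Import GRing.Theory.
Local Open Scope ring_scope.

Declare Scope lincat_scope.
Delimit Scope lincat_scope with lincat.
Local Open Scope lincat_scope.

Reserved Notation "g ∘ f" (at level 40, left associativity).
Reserved Notation "A • B" (at level 35, right associativity).
Reserved Notation "f ⊗ g" (at level 35, right associativity).

Record linearCategory (K : fieldType) := LinearCategory {
  obj :> Type;
  mor : obj -> obj -> lmodType K;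
  idm : forall A, mor A A;
  compm : forall A B C, mor B C -> mor A B -> mor A C;
  comp_id_left : forall A B (f : mor A B), compm (idm B) f = f;
  comp_id_right : forall A B (f : mor A B), compm f (idm A) = f;
  comp_assoc : forall A B C D (h : mor C D) (g : mor B C) (f : mor A B),
    compm h (compm g f) = compm (compm h g) f;
  comp_bilinear : forall A B C, bilinear_for *:%R *:%R (@compm A B C)
}.

Arguments mor {K l} A B.
Arguments idm {K l} A.
Arguments compm {K l A B C} g f.

Notation "g ∘ f" := (compm g f) : lincat_scope.

(* No unit object is required.  The associativity constraint is an explicit   *)
(* natural isomorphism [associator] with inverse [associator_inv].            *)
Record linearMonoidalCategory (K : fieldType) := LinearMonoidalCategory {
  lincat :> linearCategory K;
  tensor : lincat -> lincat -> lincat;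
  tensor_hom : forall A A' B B' : lincat,
    mor A A' -> mor B B' -> mor (tensor A B) (tensor A' B');
  tensor_hom_id : forall A B : lincat,
    tensor_hom (idm A) (idm B) = idm (tensor A B);
  tensor_hom_comp : forall (A A' A'' B B' B'' : lincat)
      (f' : mor A' A'') (f : mor A A') (g' : mor B' B'') (g : mor B B'),
    tensor_hom (f' ∘ f) (g' ∘ g) = tensor_hom f' g' ∘ tensor_hom f g;
  tensor_hom_bilinear : forall A A' B B' : lincat,
    bilinear_for *:%R *:%R (@tensor_hom A A' B B');
  associator : forall A B C : lincat,
    mor (tensor (tensor A B) C) (tensor A (tensor B C));
  associator_inv : forall A B C : lincat,
    mor (tensor A (tensor B C)) (tensor (tensor A B) C);
  associatorK : forall A B C : lincat,
    associator_inv A B C ∘ associator A B C = idm (tensor (tensor A B) C);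
  associator_invK : forall A B C : lincat,
    associator A B C ∘ associator_inv A B C = idm (tensor A (tensor B C));
  associator_natural : forall (A A' B B' C C' : lincat)
      (f : mor A A') (g : mor B B') (h : mor C C'),
    associator A' B' C' ∘ tensor_hom (tensor_hom f g) h =
    tensor_hom f (tensor_hom g h) ∘ associator A B C;
  pentagon : forall A B C D : lincat,
    associator A B (tensor C D) ∘ associator (tensor A B) C D =
    tensor_hom (idm A) (associator B C D)
      ∘ associator A (tensor B C) D
      ∘ tensor_hom (associator A B C) (idm D)
}.

Arguments tensor {K l} A B.
Arguments tensor_hom {K l A A' B B'} f g.
Arguments associator {K l} A B C.
Arguments associator_inv {K l} A B C.

Notation "A • B" := (tensor A B) : lincat_scope.
Notation "f ⊗ g" := (tensor_hom f g) : lincat_scope.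

(* In the predicates below, an equation between maps out of the triple tensor *)
(* product of A is stated on (A • A) • A, with the associator inserted        *)
(* before a map whose source is A • (A • A).                                  *)

Definition associative_monoid (K : fieldType) (C : linearMonoidalCategory K)
    (A : C) (mu : mor (A • A) A) : Prop :=
  mu ∘ (idm A ⊗ mu) ∘ associator A A A = mu ∘ (mu ⊗ idm A).

Definition dendriform_monoid (K : fieldType) (C : linearMonoidalCategory K)
    (D : C) (prec succ : mor (D • D) D) : Prop :=
  let dot := prec + succ in
  [/\ prec ∘ (prec ⊗ idm D) = prec ∘ (idm D ⊗ dot) ∘ associator D D D,
      prec ∘ (succ ⊗ idm D) = succ ∘ (idm D ⊗ prec) ∘ associator D D D
    & succ ∘ (dot ⊗ idm D) = succ ∘ (idm D ⊗ succ) ∘ associator D D D].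

Definition rota_baxter (K : fieldType) (C : linearMonoidalCategory K)
    (A : C) (mu : mor (A • A) A) (R : mor A A) : Prop :=
  mu ∘ (R ⊗ R) = R ∘ mu ∘ (R ⊗ idm A + idm A ⊗ R).

(* Main.v *)
Require Import Defs.
From mathcomp Require Import all_boot all_order all_algebra.
Import GRing.Theory.
Local Open Scope ring_scope.
Local Open Scope lincat_scope.

Section LinearMonoidalCategory.
Variables (K : fieldType) (C : linearMonoidalCategory K).

(** For (i), the three dendriform axioms add up to associativity of the sum. For (ii), each axiom is
    associativity of [mu] with [R] inserted in two of the three slots ([associative_comp_tensor]);
    the Rota-Baxter identity says that [R] carries the sum product to [mu]. *)

Lemma compmDl (X Y Z : C) (g g' : mor Y Z) (f : mor X Y) :
  (g + g') ∘ f = g ∘ f + g' ∘ f.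
Proof.
by have := (comp_bilinear (l := C) X Y Z).1 f 1 g g'; rewrite /= !scale1r.
Qed.

Lemma compmDr (X Y Z : C) (g : mor Y Z) (f f' : mor X Y) :
  g ∘ (f + f') = g ∘ f + g ∘ f'.
Proof.
by have := (comp_bilinear (l := C) X Y Z).2 g 1 f f'; rewrite /= !scale1r.
Qed.

Lemma tensor_homDl (X X' Y Y' : C) (f f' : mor X X') (g : mor Y Y') :
  (f + f') ⊗ g = f ⊗ g + f' ⊗ g.
Proof.
by have := (tensor_hom_bilinear (l := C) X X' Y Y').1 g 1 f f'; rewrite /= !scale1r.
Qed.

Lemma tensor_homDr (X X' Y Y' : C) (f : mor X X') (g g' : mor Y Y') :
  f ⊗ (g + g') = f ⊗ g + f ⊗ g'.
Proof.
by have := (tensor_hom_bilinear (l := C) X X' Y Y').2 f 1 g g'; rewrite /= !scale1r.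
Qed.

Lemma dendriform_associative (D : C) (prec succ : mor (D • D) D) :
  dendriform_monoid prec succ -> associative_monoid (succ + prec).
Proof.
case=> precA precsuccA succA; rewrite /associative_monoid addrC.
(* [succA] is applied while the inner sum under [succ] is intact; only the one under [prec] is then
   split. *)
rewrite [RHS]compmDl succA tensor_homDl compmDr precA precsuccA.
by rewrite -addrA -compmDl -compmDr -tensor_homDr -!compmDl.
Qed.

(** Associativity on generalized elements: [(f x g y) h z = f x (g y h z)]. *)
Lemma associative_comp_tensor (A : C) (mu : mor (A • A) A) (X Y Z : C)
    (f : mor X A) (g : mor Y A) (h : mor Z A) :
  associative_monoid mu ->
  mu ∘ ((mu ∘ (f ⊗ g)) ⊗ h) = mu ∘ (f ⊗ (mu ∘ (g ⊗ h))) ∘ associator X Y Z.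
Proof.
(* The inserted identities let bifunctoriality pull out [mu ⊗ idm A] and [idm A ⊗ mu]; naturality of
   the associator does the rest. *)
move=> muA; rewrite -[h in LHS]comp_id_left -[f in RHS]comp_id_left.
rewrite !tensor_hom_comp !comp_assoc -muA -!comp_assoc.
by rewrite associator_natural.
Qed.

Lemma rota_baxter_dendriform (A : C) (mu : mor (A • A) A) (R : mor A A) :
  associative_monoid mu -> rota_baxter mu R ->
  dendriform_monoid (mu ∘ (idm A ⊗ R)) (mu ∘ (R ⊗ idm A)).
Proof.
move=> muA RB.
(* [R] is multiplicative from the sum product to [mu]. *)
have Rdot : R ∘ (mu ∘ (idm A ⊗ R) + mu ∘ (R ⊗ idm A)) = mu ∘ (R ⊗ R).
  by rewrite RB -comp_assoc -compmDr addrC.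
(* The axioms are associativity at [(id, R, R)], [(R, id, R)] and [(R, R, id)]; [Rdot] serves the
   first and the last. *)
by split; rewrite -!(comp_assoc mu) -!tensor_hom_comp !comp_id_left
  ?comp_id_right ?Rdot associative_comp_tensor // -comp_assoc.
Qed.

End LinearMonoidalCategory.

Theorem proposition3p1 (K : fieldType) (C : linearMonoidalCategory K) :
  (forall (D : C) (prec succ : mor (D • D) D),
     dendriform_monoid prec succ -> associative_monoid (succ + prec)) /\
  (forall (A : C) (mu : mor (A • A) A) (R : mor A A),
     associative_monoid mu -> rota_baxter mu R ->
     dendriform_monoid (mu ∘ (idm A ⊗ R)) (mu ∘ (R ⊗ idm A))).
Proof.
split; first exact: dendriform_associative.
exact: rota_baxter_dendriform.
Qed.
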